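(* Let $h\in\mathbb N$ be fixed, let $G_n^h=(V,E)$ be the preferential attachment graph, and let $M=hn$. Then for every $\varepsilon>0$, with high probability as $n\to\infty$, $$\forall S\subseteq V:\quad \left|e(S)-\mu(\tilde S)^2\right|\le(1+\varepsilon)\,g_{\mathcal E}(h)\,\frac{M}{\sqrt h},$$ where $g_{\mathcal E}(h)=\frac{g_{\mathcal V}(h)}2+\sqrt{2\ln2}$ and $g_{\mathcal V}(h)=\frac16\sqrt{2\ln2\,(9\ln h+8\ln2)}+\frac23\ln2+2$.
   Context: $\mathbb N=\{1,2,\dots\}$, $[n]=\{1,\dots,n\}$. With high probability (as $n\to\infty$) means with probability tending to $1$ as $n\to\infty$, with $h$ and $\varepsilon$ fixed. Graphs are finite, undirected, and may have loops and multiple edges; in degrees $\deg(v)$ loops are counted twice; $e(S)$ is the number of edges (with multiplicity, loops included and counted once) with all endpoints in $S$ (here in $G_n^h$). Preferential attachment graph $G_n^h$: Phase 1. $T_1$ is the graph with the single (mini-)vertex $1$ and a single loop at it (so its degree is $2$). For $t\ge1$, given $T_t$, the graph $T_{t+1}$ is obtained by adding the mini-vertex $t+1$ and one edge joining it to a random mini-vertex $i$, where, conditionally on the history, $\Pr(i=s)=\frac{\deg_{T_t}(s)}{2t+1}$ for $1\le s\le t$ and $\Pr(i=t+1)=\frac1{2t+1}$ (a loop). Continue until $T_{hn}$, with vertex set $\tilde V=[hn]$, is obtained. Phase 2. $G_n^h$ is obtained from $T_{hn}$ by merging, for each $i\in[n]$, the mini-vertices $h(i-1)+1,\dots,h(i-1)+h$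 into a single vertex $i$, keeping loops and multiple edges. So $V=[n]$ and $|E|=hn=M$. For $S\subseteq V$, $\tilde S\subseteq[M]$ is the set of corresponding mini-vertices, $\tilde S=\bigcup_{i\in S}\{h(i-1)+1,\dots,hi\}$. For $A\subseteq[M]$ define $\mu(A)=\frac{\sqrt\pi}{2}\sum_{j\in A}c_{j-1}$, where $c_0=1$ and $c_j=\prod_{i=1}^j\frac{2i-1}{2i}$ for $j\ge1$. *)

(* Defs.v *)
From HB Require Import structures.
From mathcomp Require Import all_boot all_order all_algebra.
From mathcomp Require Import all_classical all_reals all_analysis.
Set Implicit Arguments.
Unset Strict Implicit.
Unset Printing Implicit Defensive.
Import Order.TTheory GRing.Theory Num.Theory.
Import numFieldNormedType.Exports.
Local Open Scope ring_scope.

(* Finite undirected multigraphs on V, as lists of edges.  The order of the   *)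
(* two endpoints of an edge, and the order of the list, are irrelevant.       *)
Definition multigraph (V : Type) := seq (V * V).

(* A loop contributes 2. *)
Definition deg (V : eqType) (G : multigraph V) (v : V) : nat :=
  (\sum_(x <- G) ((x.1 == v) + (x.2 == v)))%N.

Definition edges_within (V : finType) (G : multigraph V) (S : {set V}) : nat :=
  count (fun x => (x.1 \in S) && (x.2 \in S)) G.

(* Vertices and mini-vertices are numbered from 0, so that the ordinal j      *)
(* stands for the mini-vertex j + 1.  An outcome of the first phase is the    *)
(* function f sending each mini-vertex to the other endpoint of the edge that *)
(* is created together with it.                                               *)

(* T_t: the t oldest mini-vertices, each with its edge. *)
Definition pa_tree (M : nat) (f : {ffun 'I_M -> 'I_M}) (t : nat) :
    multigraph 'I_M :=
  [seq (i, f i) | i : 'I_M <- enum 'I_M & (i < t)%N].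

(* Conditional probability, given T_t, that the mini-vertex t (the one added  *)
(* to T_t) is joined to s.  For t = 0 this is 1 if s = 0, so that T_1 is a    *)
(* single loop.                                                               *)
Definition attach_prob (R : realType) (M : nat) (f : {ffun 'I_M -> 'I_M})
    (t s : 'I_M) : R :=
  if (s < t)%N then (deg (pa_tree f t) s)%:R / (2 * t + 1)%:R
  else if s == t then 1 / (2 * t + 1)%:R
  else 0.

(* Chain rule: probability of the outcome f. *)
Definition pa_weight (R : realType) (M : nat) (f : {ffun 'I_M -> 'I_M}) : R :=
  \prod_(t < M) attach_prob R f t (f t).

Lemma merge_subproof (h n : nat) (j : 'I_(h * n)) : (j %/ h < n)%N.
Proof.
case: h j => [[j /=]|h j]; first by rewrite mul0n.
by rewrite ltn_divLR // [(n * _)%N]mulnC.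
Qed.

Definition merge (h n : nat) (j : 'I_(h * n)) : 'I_n :=
  Ordinal (merge_subproof j).

Definition pa_graph (h n : nat) (f : {ffun 'I_(h * n) -> 'I_(h * n)}) :
    multigraph 'I_n :=
  [seq (merge x.1, merge x.2) | x <- pa_tree f (h * n)].

(* Probability that G_n^h satisfies Ev. *)
Definition pa_Pr (R : realType) (h n : nat) (Ev : pred (multigraph 'I_n)) : R :=
  \sum_(f : {ffun 'I_(h * n) -> 'I_(h * n)} | Ev (pa_graph f)) pa_weight R f.

Definition minis (h n : nat) (S : {set 'I_n}) : {set 'I_(h * n)} :=
  [set j | merge j \in S].

Definition c_coef (R : realType) (j : nat) : R :=
  \prod_(1 <= i < j.+1) ((2 * i%:R - 1) / (2 * i%:R)).

(* The index j - 1 of the one-based convention is j here. *)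
Definition mu (R : realType) (M : nat) (A : {set 'I_M}) : R :=
  Num.sqrt pi / 2 * \sum_(j in A) c_coef R j.

Definition gV (R : realType) (h : nat) : R :=
  1 / 6 * Num.sqrt (2 * ln 2 * (9 * ln h%:R + 8 * ln 2)) + 2 / 3 * ln 2 + 2.

Definition gE (R : realType) (h : nat) : R :=
  gV R h / 2 + Num.sqrt (2 * ln 2).

Lemma attach_prob_ge0 (R : realType) (M : nat) (f : {ffun 'I_M -> 'I_M})
  (t s : 'I_M) : 0 <= attach_prob R f t s.
Proof.
rewrite /attach_prob; case: ifP => _; first by rewrite divr_ge0.
by case: ifP => _ //; rewrite divr_ge0.
Qed.

Lemma pa_weight_ge0 (R : realType) (M : nat) (f : {ffun 'I_M -> 'I_M}) :
  0 <= pa_weight R f.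
Proof. by apply: prodr_ge0 => t _; exact: attach_prob_ge0. Qed.

Lemma pa_tree_prefix (M k : nat) (f g : {ffun 'I_M -> 'I_M}) :
  (forall i : 'I_M, (i < k)%N -> f i = g i) -> pa_tree f k = pa_tree g k.
Proof.
move=> fg; apply/eq_in_map => i.
by rewrite mem_filter => /andP[ik _]; rewrite fg.
Qed.

Lemma sum_attach_prob (R : realType) (M : nat) (f : {ffun 'I_M -> 'I_M})
  (t : 'I_M) : (forall i : 'I_M, (i < t)%N -> (f i <= i)%N) ->
  \sum_s attach_prob R f t s = 1.
Proof.
move=> fle.
have -> : \sum_s attach_prob R f t s =
    (\sum_(s < M | (s < t)%N) deg (pa_tree f t) s + 1)%:R / (2 * t + 1)%:R.
  rewrite (bigID (fun s : 'I_M => (s < t)%N)) /= natrD mulrDl; congr (_ + _).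
    rewrite natr_sum mulr_suml; apply: eq_bigr => s st.
    by rewrite /attach_prob st.
  rewrite (bigD1 t) ?ltnn //= big1 ?addr0 /attach_prob ?ltnn ?eqxx // => s.
  by case/andP => /negbTE -> /negbTE ->.
suff -> : (\sum_(s < M | (s < t)%N) deg (pa_tree f t) s = 2 * t)%N.
  by rewrite divff // pnatr_eq0 addn1.
rewrite /deg exchange_big /= big_map big_filter /=.
have sum1 (a : 'I_M) : (a < t)%N -> (\sum_(s < M | (s < t)%N) (a == s) = 1)%N.
  move=> at_; rewrite (bigD1 a) //= eqxx big1 // => s /andP[_ /negbTE].
  by rewrite eq_sym => ->.
rewrite (eq_bigr (fun=> 2)); last first.
  move=> i it; rewrite big_split /= !sum1 //.
  exact: leq_ltn_trans (fle i it) it.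
rewrite big_enum_cond /= sum_nat_const mulnC; congr (_ * _)%N.
rewrite -sum1_card -(big_ord_widen M (fun=> 1%N)) ?(ltnW (ltn_ord t)) //.
by rewrite sum1_card card_ord.
Qed.

(* pa_weight is a probability mass function. *)
Lemma sum_pa_weight (R : realType) (M : nat) :
  \sum_(f : {ffun 'I_M -> 'I_M}) pa_weight R f = 1.
Proof.
pose agree k (f0 f : {ffun 'I_M -> 'I_M}) :=
  [forall i : 'I_M, (i < k)%N ==> (f i == f0 i)].
have main d k (f0 : {ffun 'I_M -> 'I_M}) : (k + d = M)%N ->
    (forall i : 'I_M, (i < k)%N -> (f0 i <= i)%N) ->
    \sum_(f | agree k f0 f) \prod_(t < M | (k <= t)%N) attach_prob R f t (f t)
      = 1.
  elim: d k f0 => [|d IHd] k f0.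
    rewrite addn0 => -> _; rewrite (big_pred1 f0).
      by rewrite big_pred0 // => t; rewrite leqNgt ltn_ord.
    move=> f; apply/forallP/eqP => [ff0|-> i]; last by rewrite eqxx implybT.
    by apply/ffunP => i; apply/eqP; apply: (implyP (ff0 i)).
  move=> kdM f0le.
  have kM : (k < M)%N by rewrite -kdM addnS ltnS leq_addr.
  pose t := Ordinal kM.
  rewrite (partition_big (fun f : {ffun 'I_M -> 'I_M} => f t) xpredT) //=.
  rewrite -[RHS](@sum_attach_prob R M f0 t) //.
  apply: eq_bigr => s _.
  transitivity (\sum_(f | agree k f0 f && (f t == s)) attach_prob R f0 t s *
      \prod_(u < M | (k.+1 <= u)%N) attach_prob R f u (f u)).
    apply: eq_bigr => f /andP[/forallP ff0 /eqP fts].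
    rewrite (bigD1 t) //= fts; congr (_ * _).
      rewrite /attach_prob (@pa_tree_prefix _ _ f f0) // => i it.
      by apply/eqP; apply: (implyP (ff0 i)).
    by apply: eq_bigl => u; rewrite ltn_neqAle andbC eq_sym.
  rewrite -mulr_sumr.
  have [st|ts] := leqP s t; last first.
    have -> : attach_prob R f0 t s = 0.
      by rewrite /attach_prob ltnNge (ltnW ts) /= -val_eqE gtn_eqF.
    by rewrite mul0r.
  pose f1 : {ffun 'I_M -> 'I_M} := [ffun i => if i == t then s else f0 i].
  rewrite (eq_bigl (agree k.+1 f1)) ?IHd ?mulr1 // ?addSnnS //.
    move=> i; rewrite ltnS ffunE; case: eqP => [-> //|/eqP it ik].
    by apply: f0le; rewrite ltn_neqAle ik andbT; rewrite -val_eqE in it.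
  move=> f; apply/andP/forallP => [[/forallP ff0 /eqP ft] i|ff1].
    apply/implyP; rewrite ltnS ffunE; case: (i =P t) => [->|/eqP it ik].
      by rewrite ft.
    apply: (implyP (ff0 i)).
    by rewrite ltn_neqAle ik andbT; rewrite -val_eqE in it.
  split; last by have := implyP (ff1 t) (leqnn _); rewrite ffunE eqxx.
  apply/forallP => i; apply/implyP => ik.
  have := implyP (ff1 i) (ltnW ik).
  by rewrite ffunE (_ : (i == t) = false) // -val_eqE ltn_eqF.
rewrite -[RHS](main M 0 [ffun i => i]) //; apply: eq_bigl => f.
by apply/esym/forallP.
Qed.

(* Main.v *)
Require Import Defs.
From mathcomp Require Import all_boot all_order all_algebra.
From mathcomp Require Import all_classical all_reals all_analysis.
From mathcomp Require Import zify ring lra.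
Set Implicit Arguments.
Unset Strict Implicit.
Unset Printing Implicit Defensive.
Import Order.TTheory GRing.Theory Num.Theory.
Import numFieldNormedType.Exports.
Local Open Scope classical_set_scope.
Local Open Scope ring_scope.

(* Let [D t] be the total degree of [S] in [T_t], [e t] the number of edges of
   [T_t] inside [S], and [c t = c_coef R t]; sums over [S] run over mini-vertices.
   Both [c t * D t - \sum_(j in S, j < t) c j] and
   [e t - D t * (D t + 1) / (2 * (2 * t + 1))] are martingales.  Hence
   [e M - mu S ^ 2] is, up to 1, at most the absolute value of the second one
   plus [1 / c M] times that of the first one, since [pi * c M ^ 2] is [1 / M]
   up to lower order (Wallis).

   The second martingale has increments of range at most 1, so Hoeffding's bound
   and a union over the 2^n sets control it.  A plain union bound for the first
   one would lose a factor [sqrt (ln h)]; but its value at time [t] depends only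
   on the vertices born before [t], so in the k-th time block, ending near
   [M / 4^k], a union over about 2^(n / 4^k) sets is enough, and the
   contributions of the blocks decrease geometrically.  What happens before time
   [M / 4^K], with [4^K >= 1600 h], is bounded deterministically. *)

(** * Hoeffding's lemma and Wallis's bounds *)

Lemma is_derive_ge0_le {R : realType} (f f' : R -> R) (a b : R) :
  a <= b -> (forall x : R, is_derive x 1 f (f' x)) ->
  (forall x, a < x -> x < b -> 0 <= f' x) -> f a <= f b.
Proof.
move=> ab df f'ge0.
apply: (@ger0_derive1_ndecr R f a b) => //.
  move=> x; rewrite in_itv/= => /andP[ax xb].
  by rewrite derive1E (@derive_val _ _ _ _ _ _ _ (df x)) f'ge0.
by apply: derivable_within_continuous.
Qed.

(** The logarithm of the moment generating function of a centred Bernoulli variable vanishes to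
    first order at 0 and has second derivative at most 1/4. *)
Lemma hoeffding_bernoulli_ge0 {R : realType} (p d : R) :
  0 <= p <= 1 -> 0 <= d ->
  p * expR (d * (1 - p)) + (1 - p) * expR (d * (0 - p)) <= expR (d ^+ 2 / 8).
Proof.
move=> /andP[p0 p1] d0.
pose v (s : R) : R := 1 - p + p * expR s.
have v_gt0 (s : R) : 0 < v s.
  rewrite /v; have := expR_gt0 s; have [->|p_neq1] := eqVneq p 1.
    by rewrite subrr add0r mul1r.
  move=> e0; have p_lt1 : p < 1 by rewrite lt_neqAle p_neq1.
  by rewrite ltr_wpDr ?subr_gt0 // mulr_ge0 // ltW.
pose k (s : R) : R := s / 4 + p - p * expR s * (v s)^-1.
have dv (s : R) : is_derive s 1 v (p * expR s).
  by apply: is_derive_eq; rewrite /GRing.scale/= ; ring.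
have dk (s : R) : is_derive s 1 k (4^-1 - (1 - p) * (p * expR s) / v s ^+ 2).
  have v_neq0 : v s != 0 by rewrite gt_eqF.
  have dV := @is_deriveV _ v s (p * expR s) 1 v_neq0 (dv s).
  apply: is_derive_eq; rewrite /GRing.scale/= /v in v_neq0 *.
  by field.
pose g (s : R) : R := s ^+ 2 / 8 + p * s - ln (v s).
have dg (s : R) : is_derive s 1 g (k s).
  have dl := is_derive1_ln (v_gt0 s).
  have := @is_derive1_comp R (@ln R) v s _ _ dl (dv s).
  move=> dlv; apply: is_derive_eq; rewrite /GRing.scale/= /k.
  by field; rewrite gt_eqF.
have k_ge0 (s : R) : 0 <= s -> 0 <= k s.
  move=> s0; have <- : k 0 = 0.
    by rewrite /k /v expR0 mulr1 subrK invr1 mul0r add0r mulr1 subrr.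
  apply: (@is_derive_ge0_le R k _ 0 s s0 dk) => x _ _.
  (* AM-GM: four times the product of [1 - p] and [p * expR x] is at most the square of their sum
     [v x]. *)
  rewrite subr_ge0 ler_pdivrMr ?exprn_gt0// /v.
  rewrite -subr_ge0 (_ : _ - _ = (1 - p - p * expR x) ^+ 2 / 4) ?divr_ge0 ?sqr_ge0//.
  by field.
have : g 0 <= g d.
  by apply: (@is_derive_ge0_le R g _ 0 d d0 dg) => x x0 _; apply/k_ge0/ltW.
rewrite {1}/g /v expR0 expr0n /= mul0r mulr0 mulr1 subrK ln1 addr0 subrr.
rewrite /g subr_ge0 => lnv.
have : v d <= expR (d ^+ 2 / 8 + p * d).
  by rewrite -[leLHS](@lnK R) ?ler_expR // posrE.
rewrite expRD => vle.
have -> : p * expR (d * (1 - p)) + (1 - p) * expR (d * (0 - p)) = v d * expR (- (p * d)).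
  rewrite /v mulrDl mulrDr mulr1 expRD sub0r [d * - p]mulrN (mulrC d p); ring.
by rewrite -(@ler_pM2r _ (expR (p * d))) ?expR_gt0 // -mulrA -expRD addNr expR0 mulr1.
Qed.

(** Exchanging [p] with [1 - p] turns [d] into [- d]. *)
Lemma hoeffding_bernoulli {R : realType} (p d : R) :
  0 <= p <= 1 ->
  p * expR (d * (1 - p)) + (1 - p) * expR (d * (0 - p)) <= expR (d ^+ 2 / 8).
Proof.
move=> p01; have [d0|d0] := leP 0 d; first exact: hoeffding_bernoulli_ge0.
have q01 : 0 <= 1 - p <= 1 by lra.
have Nd0 : 0 <= - d by rewrite oppr_ge0 ltW.
have := hoeffding_bernoulli_ge0 q01 Nd0.
rewrite sqrrN addrC; apply: le_trans; rewrite le_eqVlt; apply/orP; left; apply/eqP.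
by congr (_ * expR _ + _ * expR _); ring.
Qed.

(* It vanishes at 0, so its value at [pi / 2] is Wallis's integral of [cos ^+ n]. *)
Fixpoint cos_pow_primitive {R : realType} (n : nat) : R -> R :=
  match n with
  | 0 => id
  | 1 => sin
  | m.+2 => fun x =>
      (sin x * cos x ^+ m.+1 + m.+1%:R * cos_pow_primitive m x) / m.+2%:R
  end.

(** The recursion is integration by parts; it jumps by two, so the induction carries two consecutive
    exponents. *)
Lemma is_derive_cos_pow_primitive {R : realType} (n : nat) (x : R) :
  is_derive x 1 (cos_pow_primitive n) (cos x ^+ n).
Proof.
suff : is_derive x 1 (cos_pow_primitive n) (cos x ^+ n) /\
       is_derive x 1 (cos_pow_primitive n.+1) (cos x ^+ n.+1) by case.
elim: n => [|n [IH0 IH1]] /=.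
  split; first by rewrite expr0; apply: is_derive_id.
  by rewrite expr1; apply: is_derive_sin.
split; first exact: IH1.
have dsc := is_deriveM (is_derive_sin x) (is_deriveX n.+1 (is_derive_cos x)).
have dF := is_deriveZ n.+1%:R IH0.
have := is_deriveZ n.+2%:R^-1 (is_deriveD dsc dF).
rewrite (_ : _ \*: _ = fun y =>
    (sin y * cos y ^+ n.+1 + n.+1%:R * cos_pow_primitive n y) / n.+2%:R); last first.
  by apply/funext => y; rewrite /= exprfctE /GRing.scale/= [LHS]mulrC.
move=> H; apply: (@is_derive_eq _ _ _ _ _ _ _ _ H); rewrite /GRing.scale /= exprfctE.
have s2 : sin x ^+ 2 = 1 - cos x ^+ 2 by rewrite -(cos2Dsin2 x) addrC addKr.
rewrite (_ : n.+2%:R^-1 * _ = n.+2%:R^-1 *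
    (cos x ^+ n.+2 + n.+1%:R * cos x ^+ n * (1 - sin x ^+ 2))).
  by rewrite s2 -[n.+2%:R]natr1 !exprS; field; rewrite nat1r natr1 pnatr_eq0.
by rewrite !exprS; ring.
Qed.

Lemma cos_pow_primitive0 {R : realType} (n : nat) :
  cos_pow_primitive n 0 = 0 :> R.
Proof.
suff : cos_pow_primitive n 0 = 0 :> R /\ cos_pow_primitive n.+1 0 = 0 :> R by case.
elim: n => [|n [IH0 IH1]] /=; first by rewrite sin0.
by split; rewrite ?IH1 // IH0 sin0 mul0r mulr0 addr0 mul0r.
Qed.

Definition wallis {R : realType} (n : nat) : R := cos_pow_primitive n (pi / 2).

Lemma wallisS2 {R : realType} (n : nat) :
  wallis n.+2 = n.+1%:R / n.+2%:R * wallis n :> R.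
Proof.
rewrite /wallis /= (_ : cos (pi / 2) = 0) ?cos_pihalf //.
by rewrite expr0n mulr0 add0r mulrAC.
Qed.

Lemma wallis_le {R : realType} (n : nat) : wallis n.+1 <= wallis n :> R.
Proof.
have pi2 : 0 <= pi / 2 :> R by rewrite divr_ge0 ?pi_ge0.
have d (x : R) : is_derive x 1 (cos_pow_primitive n - cos_pow_primitive n.+1 : R -> R)
    (cos x ^+ n - cos x ^+ n.+1).
  by apply: is_deriveB; apply: is_derive_cos_pow_primitive.
have := is_derive_ge0_le pi2 d.
rewrite !fctE !cos_pow_primitive0 subrr subr_ge0; apply => x x0 xpi.
have c0 : 0 <= cos x.
  by apply: cos_ge0_pihalf; rewrite (ltW xpi) andbT (le_trans _ (ltW x0)) // oppr_le0.
by rewrite exprS -{1}[_ ^+ n]mul1r -mulrBl mulr_ge0 ?exprn_ge0 // subr_ge0 cos_le1.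
Qed.

Lemma c_coef0 {R : realType} : c_coef R 0 = 1.
Proof. by rewrite /c_coef big_geq. Qed.

Lemma c_coefS {R : realType} (j : nat) :
  c_coef R j.+1 = c_coef R j * ((2 * j + 1)%:R / (2 * j + 2)%:R).
Proof.
rewrite /c_coef big_nat_recr //=; congr (_ * (_ / _));
  by rewrite -[j.+1%:R]natr1 natrD natrM; ring.
Qed.

Lemma c_coef_gt0 {R : realType} (j : nat) : 0 < c_coef R j.
Proof.
elim: j => [|j IH]; first by rewrite c_coef0.
by rewrite c_coefS mulr_gt0 // divr_gt0 // ltr0n ?addn1 ?addn2.
Qed.

Lemma wallis_even {R : realType} (n : nat) :
  wallis (2 * n) = pi / 2 * c_coef R n.
Proof.
elim: n => [|n IH]; first by rewrite muln0 c_coef0 mulr1.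
by rewrite mulnS add2n wallisS2 IH c_coefS mulrCA addn1 addn2
  [_ * c_coef R n]mulrC -mulrA.
Qed.

Lemma wallis_odd {R : realType} (n : nat) :
  wallis (2 * n).+1 * ((2 * n + 1)%:R * c_coef R n) = 1.
Proof.
elim: n => [|n IH].
  by rewrite muln0 c_coef0 /wallis /= sin_pihalf !mulr1.
rewrite mulnS add2n wallisS2 c_coefS -[RHS]IH.
rewrite !(natrD, natrM, mulrS). field.
have n0 : 0 <= n%:R :> R by [].
by apply/andP; split; apply/eqP; lra.
Qed.

(** Compare [wallis] at [2 * n + 1] and at [2 * n], then multiply by the inverse of the former. *)
Lemma c_coef_sqr_ge {R : realType} (n : nat) :
  1 <= pi * c_coef R n ^+ 2 * (n%:R + 2^-1).
Proof.
have := @wallis_le R (2 * n); rewrite wallis_even => /ler_wpM2r.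
move=> /(_ ((2 * n + 1)%:R * c_coef R n)); rewrite wallis_odd.
rewrite mulr_ge0 ?(ltW (c_coef_gt0 _)) // => /(_ isT) /le_trans; apply.
by rewrite le_eqVlt; apply/orP; left; apply/eqP; rewrite natrD natrM; field.
Qed.

(** For positive [n], compare [wallis] at [2 * n] and at [2 * n - 1] instead. *)
Lemma c_coef_sqr_le {R : realType} (n : nat) :
  pi * c_coef R n ^+ 2 * n%:R <= 1.
Proof.
case: n => [|n]; first by rewrite mulr0.
have := @wallis_le R (2 * n).+1.
rewrite -add2n -mulnS wallis_even => /ler_wpM2r.
move=> /(_ ((2 * n + 1)%:R * c_coef R n)); rewrite wallis_odd.
rewrite mulr_ge0 ?(ltW (c_coef_gt0 _)) // => /(_ isT); apply: le_trans.
rewrite le_eqVlt; apply/orP; left; apply/eqP.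
rewrite c_coefS; field.
by have n0 : 0 <= n%:R :> R by []; apply/eqP; lra.
Qed.

(** * Concentration along the attachment process *)

Section Attachment.
Context {R : realType} {M : nat}.
Implicit Types (f g : {ffun 'I_M -> 'I_M}) (S : {set 'I_M}) (t : nat).

(** All outcomes of nonzero weight have this property, and it guarantees that the attachment
    probabilities sum to 1. *)
Definition backward f t := forall i : 'I_M, (i < t)%N -> (f i <= i)%N.

Definition agree_below t f g := forall i : 'I_M, (i < t)%N -> f i = g i.

Definition update f (u s : 'I_M) : {ffun 'I_M -> 'I_M} :=
  [ffun i => if i == u then s else f i].

Lemma agree_below_update f (u s : 'I_M) : agree_below u f (update f u s).
Proof. by move=> i iu; rewrite ffunE -val_eqE (ltn_eqF iu). Qed.

Lemma update_id f (u s : 'I_M) : update f u s u = s.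
Proof. by rewrite ffunE eqxx. Qed.

(** The sum over [s] is the conditional expectation given the history [f] before [u], with
    [update f u s] the extended history; the one-step inequality is iterated. *)
Lemma pa_supermartingale (G : nat -> {ffun 'I_M -> 'I_M} -> R)
    (f0 : {ffun 'I_M -> 'I_M}) :
  (forall t f g, agree_below t f g -> G t f = G t g) ->
  (forall (u : 'I_M) f, backward f u ->
     \sum_s attach_prob R f u s * G u.+1 (update f u s) <= G u f) ->
  \sum_f pa_weight R f * G M f <= G 0 f0.
Proof.
move=> G_adapted G_step.
pose agree k (g f : {ffun 'I_M -> 'I_M}) :=
  [forall i : 'I_M, (i < k)%N ==> (f i == g i)].
have agreeP k g f : agree k g f -> agree_below k f g.
  by move=> /forallP gf i ik; apply/eqP; apply: (implyP (gf i)).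
(* The left side is the conditional expectation of [G M] given the first [k] edges; [d] counts the
   edges still to come. *)
have main d k f : (k + d = M)%N -> backward f k ->
    \sum_(g | agree k f g)
      (\prod_(u < M | (k <= u)%N) attach_prob R g u (g u)) * G M g <= G k f.
  elim: d k f => [|d IHd] k f.
    rewrite addn0 => -> _; rewrite (big_pred1 f).
      by rewrite big_pred0 ?mul1r // => u; rewrite leqNgt ltn_ord.
    move=> g; apply/idP/eqP => [/agreeP fg|->]; last first.
      by apply/forallP => i; rewrite eqxx implybT.
    by apply/ffunP => i; apply: fg.
  move=> kdM fle.
  have kM : (k < M)%N by rewrite -kdM addnS ltnS leq_addr.
  pose u := Ordinal kM.
  rewrite (partition_big (fun g : {ffun 'I_M -> 'I_M} => g u) xpredT) //=.
  apply: le_trans (G_step u f fle); apply: ler_sum => s _.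
  have -> : \sum_(g | agree k f g && (g u == s))
        (\prod_(w < M | (k <= w)%N) attach_prob R g w (g w)) * G M g =
      attach_prob R f u s * \sum_(g | agree k f g && (g u == s))
        (\prod_(w < M | (k.+1 <= w)%N) attach_prob R g w (g w)) * G M g.
    rewrite mulr_sumr; apply: eq_bigr => g /andP[/agreeP fg /eqP gus].
    rewrite mulrA (bigD1 u) //= gus; congr (_ * _ * _).
      by rewrite /attach_prob (@pa_tree_prefix _ _ g f).
    by apply: eq_bigl => w; rewrite ltn_neqAle andbC eq_sym.
  (* An end later than [u] would make the extended history not backward, but it has probability
     0. *)
  have [su|us] := leqP s u; last first.
    have -> : attach_prob R f u s = 0.
      by rewrite /attach_prob ltnNge (ltnW us) /= -val_eqE gtn_eqF.
    by rewrite !mul0r.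
  apply: ler_wpM2l; first exact: attach_prob_ge0.
  rewrite (eq_bigl (agree k.+1 (update f u s))) ?IHd ?addSnnS //.
    move=> i; rewrite ltnS ffunE; case: eqP => [-> //|/eqP iu ik].
    by apply: fle; rewrite ltn_neqAle ik andbT; rewrite -val_eqE in iu.
  move=> g; apply/andP/idP => [[/agreeP fg /eqP gu]|/agreeP fg].
    apply/forallP => i; apply/implyP; rewrite ltnS ffunE.
    case: (i =P u) => [->|/eqP iu ik]; first by rewrite gu.
    by apply/eqP/fg; rewrite ltn_neqAle ik andbT; rewrite -val_eqE in iu.
  split; last by rewrite fg ?update_id.
  apply/forallP => i; apply/implyP => ik.
  by rewrite (fg i (leqW ik)) -(agree_below_update f s (ik : (i < u)%N)).
rewrite (eq_bigl (agree 0 f0)); last by move=> f; apply/esym/forallP.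
exact: (main M).
Qed.

(* The total degree of [S] in [T_t]. *)
Definition volume S f t : R :=
  \sum_(i < M | (i < t)%N) ((i \in S)%:R + (f i \in S)%:R).

(** For a backward history, the conditional probability that the edge of [u] ends in [S]; the
    summand [u \in S] is for a loop at [u]. *)
Definition hit_prob S f (u : 'I_M) : R :=
  (volume S f u + (u \in S)%:R) / (2 * u + 1)%:R.

Definition hit_dev S f (u : 'I_M) : R := (f u \in S)%:R - hit_prob S f u.

Lemma volume_agree S t f g : agree_below t f g -> volume S f t = volume S g t.
Proof. by move=> fg; apply: eq_bigr => i it; rewrite fg. Qed.

Lemma hit_prob_agree S f g (u : 'I_M) :
  agree_below u f g -> hit_prob S f u = hit_prob S g u.
Proof. by move=> fg; rewrite /hit_prob (volume_agree S fg). Qed.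

Lemma volume0 S f : volume S f 0 = 0.
Proof. by rewrite /volume big_pred0. Qed.

Lemma volumeS S f (u : 'I_M) :
  volume S f u.+1 = volume S f u + (u \in S)%:R + (f u \in S)%:R.
Proof.
rewrite /volume (bigD1 u) //= addrC -addrA; congr (_ + _).
by apply: eq_bigl => i; rewrite ltnS ltn_neqAle andbC.
Qed.

Lemma volume_ge0 S f t : 0 <= volume S f t.
Proof. by apply: sumr_ge0 => i _; rewrite addr_ge0. Qed.

Lemma volume_le S f t : volume S f t <= (2 * t)%:R.
Proof.
apply: (@le_trans _ _ (\sum_(i < M | (i < t)%N) 2%:R)).
  apply: ler_sum => i _; rewrite -natrD ler_nat.
  by case: (_ \in S); case: (_ \in S).
rewrite sumr_const -mulrnA ler_nat leq_mul2l /=.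
have [tM|Mt] := leqP t M.
  by rewrite -sum1_card -(big_ord_widen M (fun=> 1%N)) // sum1_card card_ord.
by rewrite (leq_trans (max_card _)) // card_ord ltnW.
Qed.

Lemma hit_prob_ge0_le1 S f (u : 'I_M) : 0 <= hit_prob S f u <= 1.
Proof.
have u1 : 0 < (2 * u + 1)%:R :> R by rewrite ltr0n addn1.
rewrite divr_ge0 ?addr_ge0 ?volume_ge0 //= ler_pdivrMr // mul1r natrD.
by rewrite lerD ?volume_le // lern1 leq_b1.
Qed.

Lemma sum_attach_prob_in S f (u : 'I_M) : backward f u ->
  \sum_(s in S) attach_prob R f u s = hit_prob S f u.
Proof.
move=> fle.
have sum1 (v : 'I_M) : (v < u)%N ->
    \sum_(s in S | (s < u)%N) (v == s)%:R = (v \in S)%:R :> R.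
  move=> vu; have [vS|vS] := boolP (v \in S).
    rewrite (bigD1 v) ?vS //= eqxx big1 ?addr0 // => s /andP[_ /negbTE].
    by rewrite eq_sym => ->.
  by rewrite big1 // => s /andP[sS _]; case: eqP sS vS => // -> ->.
rewrite (bigID (fun s : 'I_M => (s < u)%N)) /= /hit_prob mulrDl; congr (_ + _).
  rewrite (eq_bigr (fun s => (deg (pa_tree f u) s)%:R / (2 * u + 1)%:R)).
    rewrite -mulr_suml; congr (_ / _).
    under eq_bigr do rewrite /deg natr_sum big_map big_filter.
    rewrite exchange_big /= big_enum_cond /=; apply: eq_bigr => i iu.
    under eq_bigr do rewrite natrD.
    by rewrite big_split /= !sum1 // (leq_ltn_trans (fle i iu)).
  by move=> s /andP[_ su]; rewrite /attach_prob su.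
rewrite (bigID (pred1 u)) /= [X in _ + X]big1 ?addr0; last first.
  by move=> s /andP[/andP[_ /negbTE su] /negbTE us]; rewrite /attach_prob su us.
have [uS|uS] := boolP (u \in S); last first.
  rewrite big1 ?mul0r // => s /andP[/andP[sS _] /eqP us].
  by rewrite us (negbTE uS) in sS.
rewrite (big_pred1 u); first by rewrite /attach_prob ltnn eqxx.
by move=> s /=; have [->|] := eqVneq s u; rewrite ?uS ?ltnn ?andbF.
Qed.

End Attachment.

(** * Azuma-Hoeffding tail bounds for sums of predictable multiples of [hit_dev] *)

Section Concentration.
Context {R : realType} {M : nat}.
Implicit Types (f g : {ffun 'I_M -> 'I_M}) (S : {set 'I_M}) (t : nat).

Lemma attach_mgf_le S f (u : 'I_M) (d : R) : backward f u ->
  \sum_s attach_prob R f u s * expR (d * ((s \in S)%:R - hit_prob S f u)) <=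
  expR (d ^+ 2 / 8).
Proof.
move=> fle; set p := hit_prob S f u.
have -> : \sum_s attach_prob R f u s * expR (d * ((s \in S)%:R - p)) =
    p * expR (d * (1 - p)) + (1 - p) * expR (d * (0 - p)).
  have pE : \sum_(s in S) attach_prob R f u s = p := sum_attach_prob_in S fle.
  have qE : \sum_(s | s \notin S) attach_prob R f u s = 1 - p.
    have := sum_attach_prob R fle.
    by rewrite (bigID (mem S)) /= pE => <-; rewrite addrC addrK.
  rewrite -[X in X * expR (d * (1 - p))]pE -[X in _ = _ + X * _]qE.
  rewrite (bigID (mem S)) /= !mulr_suml.
  congr (_ + _); apply: eq_bigr => s; first by move=> ->.
  by move=> /negbTE ->.
exact/hoeffding_bernoulli/hit_prob_ge0_le1.
Qed.

Definition predictable (d : 'I_M -> {ffun 'I_M -> 'I_M} -> R) :=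
  forall (u : 'I_M) f g, agree_below u f g -> d u f = d u g.

(** By Hoeffding's lemma, subtracting [b u ^+ 2 / 8] at each step makes the exponential of the
    partial sums a supermartingale started at 1. *)
Lemma pa_mgf_le S (d : 'I_M -> {ffun 'I_M -> 'I_M} -> R) (b : 'I_M -> R) :
  predictable d -> (forall u f, `|d u f| <= b u) ->
  \sum_f pa_weight R f * expR (\sum_u d u f * hit_dev S f u) <=
  expR ((\sum_u b u ^+ 2) / 8).
Proof.
move=> d_pred d_le.
pose G t f :=
  expR (\sum_(u < M | (u < t)%N) (d u f * hit_dev S f u - b u ^+ 2 / 8)).
have GM f : expR (\sum_u d u f * hit_dev S f u) =
    G M f * expR ((\sum_u b u ^+ 2) / 8).
  rewrite /G -expRD mulr_suml; congr expR.
  by under [X in _ = X + _]eq_bigl do rewrite ltn_ord; rewrite sumrB subrK.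
under eq_bigr do rewrite GM mulrA.
rewrite -mulr_suml -[leRHS]mul1r ler_wpM2r ?expR_ge0 //.
pose f0 : {ffun 'I_M -> 'I_M} := [ffun i => i].
have -> : 1 = G 0%N f0 by rewrite /G big_pred0 ?expR0.
have G_adapted t f g : agree_below t f g -> G t f = G t g.
  move=> fg; rewrite /G; congr expR; apply: eq_bigr => u ut.
  have fgu : agree_below u f g by move=> i iu; apply/fg/(ltn_trans iu).
  by rewrite (d_pred u f g) // /hit_dev fg // (hit_prob_agree S fgu).
apply: pa_supermartingale => // u f fle.
have GS s : G u.+1 (update f u s) =
    G u f * (expR (d u f * ((s \in S)%:R - hit_prob S f u)) *
             expR (- (b u ^+ 2 / 8))).
  have fs := agree_below_update f s : agree_below u f (update f u s).
  rewrite (G_adapted _ _ _ fs) /G -!expRD; congr expR.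
  rewrite (bigD1 u) //= addrC; congr (_ + _).
    by apply: eq_bigl => i; rewrite ltnS ltn_neqAle andbC.
  by rewrite /hit_dev update_id -(hit_prob_agree S fs) -(d_pred u _ _ fs).
under eq_bigr do rewrite GS mulrCA [X in _ * X]mulrA.
rewrite -mulr_sumr -mulr_suml -[leRHS]mulr1 ler_wpM2l ?expR_ge0 //.
rewrite expRN ler_pdivrMr ?expR_gt0 // mul1r.
apply: le_trans (attach_mgf_le _ _ fle) _; rewrite ler_expR.
rewrite ler_pM2r ?invr_gt0 // -[leLHS]real_normK ?num_real //.
by rewrite lerXn2r ?nnegrE ?(le_trans _ (d_le u f)).
Qed.

Definition pa_prob (A : pred {ffun 'I_M -> 'I_M}) : R :=
  \sum_(f | A f) pa_weight R f.

Lemma pa_weight_neq0_backward f : pa_weight R f != 0 -> backward f M.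
Proof.
move=> /prodf_neq0 wf u _; have := wf u isT.
rewrite /attach_prob; case: ifP => [/ltnW //|_]; case: ifP => [/eqP -> //|_].
by rewrite eqxx.
Qed.

(** Markov's inequality; it is enough to test backward outcomes, all others having weight 0. *)
Lemma pa_prob_le (A : pred {ffun 'I_M -> 'I_M}) (F : {ffun 'I_M -> 'I_M} -> R) :
  (forall f, 0 <= F f) -> (forall f, backward f M -> A f -> 1 <= F f) ->
  pa_prob A <= \sum_f pa_weight R f * F f.
Proof.
move=> F0 F1; rewrite /pa_prob big_mkcond /=; apply: ler_sum => f _.
case: ifP => [Af|_]; last by rewrite mulr_ge0 ?pa_weight_ge0.
have [->|wf] := eqVneq (pa_weight R f) 0; first by rewrite mul0r.
by rewrite ler_peMr ?pa_weight_ge0 ?F1 //; apply: pa_weight_neq0_backward.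
Qed.

Lemma pa_prob_union (J : finType) (Q : pred J)
    (A : pred {ffun 'I_M -> 'I_M}) (B : J -> pred {ffun 'I_M -> 'I_M}) :
  (forall f, backward f M -> A f -> exists2 j, Q j & B j f) ->
  pa_prob A <= \sum_(j | Q j) pa_prob (B j).
Proof.
move=> AB; apply: le_trans
  (@pa_prob_le A (fun f => \sum_(j | Q j) (B j f)%:R) _ _) _.
- by move=> f; apply: sumr_ge0.
- move=> f fle /(AB _ fle)[j Qj Bj]; rewrite (bigD1 j) //= Bj lerDl.
  exact: sumr_ge0.
under eq_bigr do rewrite mulr_sumr.
rewrite exchange_big /=; apply: ler_sum => j _.
rewrite /pa_prob [leRHS]big_mkcond /=; apply: ler_sum => f _.
by case: (B j f); rewrite ?mulr1 ?mulr0.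
Qed.

Lemma pa_prob_tail S (d : 'I_M -> {ffun 'I_M -> 'I_M} -> R) (b : 'I_M -> R)
    (K l : R) :
  predictable d -> (forall u f, `|d u f| <= b u) ->
  \sum_u b u ^+ 2 <= K -> 0 < K -> 0 <= l ->
  pa_prob (fun f => l < `|\sum_u d u f * hit_dev S f u|) <=
  2 * expR (- (2 * l ^+ 2 / K)).
Proof.
move=> d_pred d_le bK K0 l0.
(* This value minimises the Chernoff exponent [a ^+ 2 * K / 8 - a * l]. *)
have [a aE] : exists a, a = 4 * l / K by eexists.
have a0 : 0 <= a by rewrite aE divr_ge0 ?mulr_ge0 // ltW.
pose Z f : R := \sum_u d u f * hit_dev S f u.
have side (e : R) : `|e| = 1 ->
    \sum_f pa_weight R f * expR (a * (e * Z f - l)) <= expR (- (2 * l ^+ 2 / K)).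
  move=> e1.
  have -> : - (2 * l ^+ 2 / K) = a ^+ 2 * K / 8 - a * l.
    by rewrite aE; field; rewrite gt_eqF.
  under eq_bigr do rewrite mulrBr expRD mulrA.
  rewrite -mulr_suml expRD ler_wpM2r ?expR_ge0 //.
  pose d' u f := a * e * d u f.
  have d'_pred : predictable d' by move=> u f g fg; rewrite /d' (d_pred u f g).
  have d'_le u f : `|d' u f| <= a * b u.
    by rewrite /d' !normrM e1 mulr1 ger0_norm // ler_wpM2l.
  have := pa_mgf_le S d'_pred d'_le.
  under eq_bigr => f _.
    rewrite (_ : \sum_u _ = a * (e * Z f)); last first.
      by rewrite /Z !mulr_sumr; apply: eq_bigr => u _; rewrite /d' !mulrA.
  over.
  move=> /le_trans; apply; rewrite ler_expR ler_pM2r ?invr_gt0 //.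
  under eq_bigr do rewrite exprMn.
  by rewrite -mulr_sumr ler_wpM2l ?sqr_ge0.
have ge1 (x : R) : 0 <= x -> 1 <= expR x.
  by move=> x0; rewrite -[leLHS]expR0 ler_expR.
apply: le_trans (@pa_prob_le _ (fun f =>
  expR (a * (1 * Z f - l)) + expR (a * (-1 * Z f - l))) _ _) _.
- by move=> f; rewrite addr_ge0 ?expR_ge0.
- move=> f _; rewrite lter_normr => /orP[] lZ.
    by rewrite -[leLHS]addr0 lerD ?expR_ge0 // ge1 // mulr_ge0 // mul1r subr_ge0 ltW.
  by rewrite -[leLHS]add0r lerD ?expR_ge0 // ge1 // mulr_ge0 // mulN1r subr_ge0 ltW.
under eq_bigr do rewrite mulrDr.
rewrite big_split /= mulr2n mulrDl mul1r lerD //; apply: side.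
  by rewrite normr1.
by rewrite normrN1.
Qed.

End Concentration.

(** * Degree and edge martingales *)

(** Telescoping, because [c_coefS] says that [(2 * t + 2) * c (t + 1) = (2 * t + 1) * c t]. *)
Lemma sum_c_coef {R : realType} (t : nat) :
  \sum_(0 <= j < t) c_coef R j = (2 * t)%:R * c_coef R t.
Proof.
elim: t => [|t IH]; first by rewrite big_geq // muln0 mul0r.
rewrite big_nat_recr //= IH c_coefS; field.
have t0 : 0 <= t%:R :> R by [].
by apply/eqP; lra.
Qed.

Lemma c_coef_ratio_sqr_le {R : realType} (m n : nat) :
  (c_coef R m / c_coef R n) ^+ 2 * m%:R <= n%:R + 2^-1.
Proof.
have cn := c_coef_gt0 (R := R) n.
rewrite expr_div_n mulrAC ler_pdivrMr ?exprn_gt0 //.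
rewrite -(@ler_pM2l _ pi) ?pi_gt0 // mulrA [leRHS]mulrCA [leRHS]mulrC.
exact: le_trans (c_coef_sqr_le m) (c_coef_sqr_ge n).
Qed.

Lemma sum_inv_dyadic_le {R : realType} (s : nat) :
  \sum_(s <= u < 2 * s) u.+1%:R^-1 <= 1 :> R.
Proof.
case: s => [|s]; first by rewrite big_geq.
apply: (@le_trans _ _ (\sum_(s.+1 <= u < 2 * s.+1) s.+1%:R^-1 : R)).
  rewrite !big_seq; apply: ler_sum => u; rewrite mem_index_iota => /andP[su _].
  by rewrite lef_pV2 ?posrE // ler_nat ltnW.
rewrite sumr_const_nat mul2n -addnn addnK -[leLHS]mulr_natl.
by rewrite mulfV // pnatr_eq0.
Qed.

Lemma sum_inv_quadruple_le {R : realType} (s t : nat) : (t <= 4 * s)%N ->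
  \sum_(s <= u < t) u.+1%:R^-1 <= 2 :> R.
Proof.
move=> ts; have [st|/ltnW ts'] := leqP s t; last by rewrite big_geq.
apply: (@le_trans _ _ (\sum_(s <= u < 4 * s) u.+1%:R^-1 : R)).
  rewrite [leRHS](big_cat_nat (n := t)) /=; [|lia..]; rewrite lerDl.
  apply: sumr_ge0 => u _.
  by rewrite invr_ge0.
rewrite (big_cat_nat (n := 2 * s)) /=; [|lia..].
rewrite [2 in leRHS]mulr2n lerD ?sum_inv_dyadic_le //.
by rewrite (_ : 4 * s = 2 * (2 * s))%N ?sum_inv_dyadic_le // mulnA.
Qed.

Section Martingales.
Context {R : realType} {M : nat}.
Implicit Types (f g : {ffun 'I_M -> 'I_M}) (S : {set 'I_M}) (s t : nat).

Lemma sum_increments (F : nat -> R) (G : 'I_M -> R) s t :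
  (forall u : 'I_M, F u.+1 = F u + G u) -> (s <= t)%N -> (t <= M)%N ->
  \sum_(u < M | (s <= u < t)%N) G u = F t - F s.
Proof.
move=> FG; elim: t => [|t IH].
  by rewrite leqn0 => /eqP -> _; rewrite big_pred0 ?subrr // => u; rewrite ltn0.
rewrite leq_eqVlt => /orP[/eqP -> _|st tM].
  by rewrite subrr big_pred0 // => u; apply/negP => /andP[/leq_trans h /h]; rewrite ltnn.
pose v := Ordinal tM.
have -> : F t.+1 = F t + G v := FG v.
rewrite (bigD1 v) /=; last by rewrite leqnn andbT.
rewrite addrAC -(IH st (ltnW tM)) addrC; congr (_ + _).
by apply: eq_bigl => u; rewrite -val_eqE /=; lia.
Qed.

(** This is [c_coef R t] times the expected volume of [S] at time [t]. *)
Definition mean_volume S t : R := \sum_(i < M | (i < t)%N && (i \in S)) c_coef R i.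

Definition volume_mart S f t : R := c_coef R t * volume S f t - mean_volume S t.

Definition inner_edges S f t : R :=
  \sum_(i < M | (i < t)%N) ((i \in S) && (f i \in S))%:R.

(* [D (D + 1) / (2 (2 t + 1))], where [D] is the volume, compensates the edges
   inside [S] exactly: if [a] tells whether [t] is in [S], then
   [(D + a) (D + a + 1) = D (D + 1) + 2 a (D + 1)]. *)
Definition edges_mart S f t : R := inner_edges S f t -
  volume S f t * (volume S f t + 1) / (2 * (2 * t + 1)%:R).

(** An indicator equals its square, so the increment of [edges_mart] is affine in the indicator of
    [f u \in S]; this is the slope. *)
Definition edges_mart_coef S (u : 'I_M) f : R :=
  (u \in S)%:R - (volume S f u + (u \in S)%:R + 1) / (2 * u + 3)%:R.

(** Once [u] has added its own endpoint, the volume grows on average by the factor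
    [c u / c (u + 1)], which the prefactor of [volume_mart] cancels. *)
Lemma volume_martS S f (u : 'I_M) :
  volume_mart S f u.+1 = volume_mart S f u + c_coef R u.+1 * hit_dev S f u.
Proof.
rewrite /volume_mart /hit_dev /hit_prob volumeS.
have -> : mean_volume S u.+1 = mean_volume S u + c_coef R u * (u \in S)%:R.
  rewrite /mean_volume; have [uS|uS] := boolP (u \in S); last first.
    rewrite mulr0 addr0; apply: eq_bigl => i; rewrite ltnS leq_eqVlt.
    by case: eqP => [/val_inj ->|//]; rewrite (negbTE uS) !andbF.
  rewrite mulr1 (bigD1 u) /= ?uS ?ltnSn // addrC; congr (_ + _).
  by apply: eq_bigl => i; rewrite andbAC ltnS [in RHS]ltn_neqAle [X in X && _]andbC.
rewrite c_coefS; field.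
have u0 : 0 <= u%:R :> R by [].
by apply/andP; split; apply/eqP; lra.
Qed.

Lemma edges_martS S f (u : 'I_M) :
  edges_mart S f u.+1 = edges_mart S f u + edges_mart_coef S u f * hit_dev S f u.
Proof.
rewrite /edges_mart /edges_mart_coef /hit_dev /hit_prob volumeS.
have -> : inner_edges S f u.+1 =
    inner_edges S f u + (u \in S)%:R * (f u \in S)%:R.
  rewrite /inner_edges (bigD1 u) //= addrC; congr (_ + _); last first.
    by case: (u \in S); case: (f u \in S); rewrite ?mulr0 ?mulr1.
  by apply: eq_bigl => i; rewrite ltnS ltn_neqAle andbC.
have u0 : 0 <= u%:R :> R by [].
case: (u \in S); case: (f u \in S) => /=; field; apply/andP; split; apply/eqP; lra.
Qed.

Lemma edges_mart_coef_le1 S (u : 'I_M) f : `|edges_mart_coef S u f| <= 1.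
Proof.
have V0 := volume_ge0 (R := R) S f u; have V2 := volume_le (R := R) S f u.
rewrite /edges_mart_coef; set V := volume S f u in V0 V2 *.
have u0 : 0 <= u%:R :> R by [].
have -> : (2 * u + 3)%:R = 2 * u%:R + 3 :> R by rewrite natrD natrM.
have u3 : 0 < 2 * u%:R + 3 :> R by lra.
rewrite natrM in V2.
case: (u \in S) => /=; rewrite ler_norml ?sub0r; apply/andP; split.
- rewrite lerBrDr addrC -lerBrDr ler_pdivrMr //; lra.
- by rewrite gerBl divr_ge0 ?ltW //; lra.
- by rewrite lerN2 ler_pdivrMr //; lra.
- by rewrite (le_trans _ ler01) // oppr_le0 divr_ge0 ?ltW //; lra.
Qed.

Lemma edges_mart_coef_predictable S : predictable (edges_mart_coef S).
Proof. by move=> u f g fg; rewrite /edges_mart_coef (volume_agree S fg). Qed.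

Lemma edges_mart_sum S f :
  edges_mart S f M = \sum_u edges_mart_coef S u f * hit_dev S f u.
Proof.
have E0 : edges_mart S f 0 = 0.
  by rewrite /edges_mart volume0 !mul0r subr0 /inner_edges big_pred0.
transitivity (edges_mart S f M - edges_mart S f 0); first by rewrite E0 subr0.
rewrite -(sum_increments (edges_martS S f)) //.
by apply: eq_bigl => u; rewrite /= ltn_ord.
Qed.

Lemma mean_volume_le S t : mean_volume S t <= (2 * t)%:R * c_coef R t.
Proof.
rewrite -sum_c_coef /mean_volume big_mkcondr /=.
apply: (@le_trans _ _ (\sum_(i < M | (i < t)%N) c_coef R i)).
  by apply: ler_sum => i _; case: ifP => // _; apply/ltW/c_coef_gt0.
have [tM|/ltnW Mt] := leqP t M.
  by rewrite big_mkord (big_ord_widen M (c_coef R)).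
rewrite (big_cat_nat (n := M)) //= big_mkord [X in X <= _](eq_bigl xpredT).
  by rewrite lerDl; apply: sumr_ge0 => i _; apply/ltW/c_coef_gt0.
by move=> i; rewrite (leq_trans (ltn_ord i)).
Qed.

Lemma mean_volume_ge0 S t : 0 <= mean_volume S t.
Proof. by apply: sumr_ge0 => i _; apply/ltW/c_coef_gt0. Qed.

Lemma volume_mart_le S f t :
  `|volume_mart S f t| <= (2 * t)%:R * c_coef R t.
Proof.
have m0 := mean_volume_ge0 S t; have m2 := mean_volume_le S t.
have c0 := c_coef_gt0 (R := R) t.
have v0 : 0 <= c_coef R t * volume S f t by rewrite mulr_ge0 ?volume_ge0 // ltW.
have v2 : c_coef R t * volume S f t <= (2 * t)%:R * c_coef R t.
  by rewrite mulrC ler_wpM2r ?volume_le // ltW.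
rewrite /volume_mart ler_norml; apply/andP; split; lra.
Qed.

Lemma edges_mu_le S f : (0 < M)%N ->
  `|inner_edges S f M - mu R S ^+ 2| <=
  `|edges_mart S f M| + `|volume_mart S f M / c_coef R M| + 1.
Proof.
move=> M0; have M0R : 1 <= M%:R :> R by rewrite ler1n.
set c := c_coef R M; have c0 : 0 < c := c_coef_gt0 M.
have muE : mu R S = Num.sqrt pi / 2 * mean_volume S M.
  by rewrite /mu /mean_volume; congr (_ * _); apply: eq_bigl => i; rewrite ltn_ord.
set D : R := volume S f M; set B := mean_volume S M / c.
have D0 : 0 <= D := volume_ge0 S f M.
have D2 : D <= 2 * M%:R by rewrite -natrM; exact: volume_le.
have B0 : 0 <= B by rewrite divr_ge0 ?mean_volume_ge0 // ltW.
have B2 : B <= 2 * M%:R by rewrite ler_pdivrMr // -natrM mean_volume_le.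
have XE : volume_mart S f M / c = D - B.
  by rewrite /volume_mart mulrBl [_ * D]mulrC mulfK // gt_eqF.
have [y y_def] : exists y : R, y = (4 * M%:R + 2)^-1 by eexists.
have y0 : 0 < y by rewrite y_def invr_gt0; lra.
have yE : y * (4 * M%:R + 2) = 1 by rewrite y_def mulVf // gt_eqF //; lra.
have eE : inner_edges S f M = edges_mart S f M + D * (D + 1) * y.
  rewrite /edges_mart -/D y_def (_ : 2 * _ = 4 * M%:R + 2) ?subrK //.
  by rewrite natrD natrM; ring.
(* By Wallis [k] is nearly [1 / M], so [k / 4] and [y] nearly agree and the main terms to compare
   are [D ^+ 2 * y] and [B ^+ 2 * y]. *)
set k := pi * c ^+ 2.
have mu2 : mu R S ^+ 2 = k / 4 * B ^+ 2.
  rewrite muE !exprMn sqr_sqrtr ?pi_ge0 // /k /B; field.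
  by rewrite gt_eqF.
have k1 : 1 <= k * (M%:R + 2^-1) := c_coef_sqr_ge M.
have k2 : k * M%:R <= 1 := c_coef_sqr_le M.
rewrite eE mu2 XE.
(* Because [D + B <= 4 * M <= 1 / y]. *)
have T1 : `|(D ^+ 2 - B ^+ 2) * y| <= `|D - B|.
  rewrite subr_sqr normrM normrM -mulrA -[leRHS]mulr1 ler_wpM2l //.
  rewrite !ger0_norm ?addr_ge0 ?(ltW y0) // -yE mulrC ler_pM2l //; lra.
have T2 : 0 <= D * y <= 2^-1.
  rewrite mulr_ge0 ?(ltW y0) //= -ler_pdivlMr // y_def invrK; lra.
(* The lower Wallis bound gives the sign, the upper one the size. *)
have T3 : 0 <= B ^+ 2 * (k / 4 - y) <= 2^-1.
  have ky : 0 <= k / 4 - y.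
    rewrite -(@pmulr_rge0 _ (4 * M%:R + 2)); last by lra.
    by rewrite mulrBr [_ * y]mulrC yE; lra.
  rewrite mulr_ge0 ?sqr_ge0 //=.
  apply: (@le_trans _ _ ((2 * M%:R) ^+ 2 * (k / 4 - y))).
    by rewrite ler_wpM2r // lerXn2r ?nnegrE // (le_trans B0).
  have : 4 * M%:R * (k / 4 - y) <= 2 * y.
    have : 4 * M%:R * y = 1 - 2 * y by lra.
    lra.
  move=> /(ler_wpM2l (ler0n R M)) H.
  rewrite (_ : (2 * M%:R) ^+ 2 * (k / 4 - y) =
    M%:R * (4 * M%:R * (k / 4 - y))); last by ring.
  apply: le_trans H _.
  lra.
have -> : edges_mart S f M + D * (D + 1) * y - k / 4 * B ^+ 2 =
    edges_mart S f M + (D ^+ 2 - B ^+ 2) * y + (D * y - B ^+ 2 * (k / 4 - y)).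
  by ring.
apply: le_trans (ler_normD _ _) _; rewrite lerD //.
  by apply: le_trans (ler_normD _ _) _; rewrite lerD.
rewrite ler_norml; apply/andP; split; lra.
Qed.

End Martingales.

(** * Union bound over time blocks *)

Section Blocks.
Context {R : realType} {M : nat}.
Implicit Types (f g : {ffun 'I_M -> 'I_M}) (S : {set 'I_M}) (s t : nat).

(** Slopes of [volume_mart / c_coef R M], cut off outside the block so that [pa_prob_tail], which
    sums over all times, applies. *)
Definition block_coef s t (u : 'I_M) f : R :=
  if (s <= u < t)%N then c_coef R u.+1 / c_coef R M else 0.

Lemma block_coef_predictable s t : predictable (block_coef s t).
Proof. by []. Qed.

Lemma block_coef_sum S f s t : (s <= t)%N -> (t <= M)%N ->
  \sum_u block_coef s t u f * hit_dev S f u =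
  (volume_mart S f t - volume_mart S f s) / c_coef R M.
Proof.
move=> st tM; rewrite -(sum_increments (volume_martS S f) st tM) mulr_suml.
rewrite [RHS]big_mkcond; apply: eq_bigr => u _; rewrite /block_coef.
by case: ifP => _; rewrite ?mul0r // mulrAC.
Qed.

(** The squares are at most [(M + 1/2) / (u + 1)], and the harmonic sum over a quadrupling of time
    is at most 2. All blocks thus share one variance bound, while later ones in the indexing need
    fewer sets. *)
Lemma block_coef_sqr_sum_le f s t : (t <= 4 * s)%N -> (t <= M)%N ->
  \sum_u block_coef s t u f ^+ 2 <= 2 * M%:R + 1.
Proof.
move=> ts tM.
apply: (@le_trans _ _ (\sum_(u < M | (s <= u < t)%N) (M%:R + 2^-1) * u.+1%:R^-1)).
  rewrite [leRHS]big_mkcond; apply: ler_sum => u _; rewrite /block_coef.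
  case: ifP => _; last by rewrite expr0n.
  by rewrite ler_pdivlMr ?ltr0n // c_coef_ratio_sqr_le.
rewrite -mulr_sumr (_ : 2 * M%:R + 1 = (M%:R + 2^-1) * 2); last by field.
rewrite ler_wpM2l ?addr_ge0 //.
have [st|/ltnW st] := leqP s t; last first.
  by rewrite big_pred0 // => u; apply/negP; lia.
have := sum_inv_quadruple_le (R := R) ts; apply: le_trans.
rewrite big_geq_mkord (big_ord_widen_cond M _ (fun u => u.+1%:R^-1 : R)) //.
Qed.

(** Backward edges before time [t] never leave the first [t] mini-vertices. This lets a block be
    tested on early sets alone. *)
Lemma volume_mart_restrict S S' f t : backward f t ->
  (forall i : 'I_M, (i < t)%N -> (i \in S) = (i \in S')) ->
  volume_mart S f t = volume_mart S' f t :> R.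
Proof.
move=> fle SS'; rewrite /volume_mart; congr (_ * _ - _).
  by apply: eq_bigr => i it; rewrite !SS' // (leq_ltn_trans (fle i it)).
apply: eq_bigl => i; have [it|//] := boolP (i < t)%N.
by rewrite /= SS'.
Qed.

End Blocks.

Lemma inner_edges_minis {R : realType} (h n : nat)
    (f : {ffun 'I_(h * n) -> 'I_(h * n)}) (S : {set 'I_n}) :
  (edges_within (pa_graph f) S)%:R = inner_edges (R := R) (minis h S) f (h * n).
Proof.
rewrite /edges_within /pa_graph /pa_tree count_map count_map count_filter.
rewrite -sum1_count natr_sum big_enum_cond /inner_edges.
rewrite [LHS]big_mkcond [RHS]big_mkcond /=.
apply: eq_bigr => i _; rewrite ltn_ord !inE /= andbT.
by case: ifP => //.
Qed.

(** For positive [n], the ceiling of [n / 4 ^ k]. Rounding up keeps consecutive values within a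
    factor 4. *)
Definition block_vertices (n k : nat) : nat := (n.-1 %/ 4 ^ k).+1.

Lemma block_vertices0 n : (0 < n)%N -> block_vertices n 0 = n.
Proof. by move=> n0; rewrite /block_vertices expn0 divn1 prednK. Qed.

Lemma block_vertices_le n k : (0 < n)%N -> (block_vertices n k <= n)%N.
Proof.
move=> n0; rewrite /block_vertices -[leqRHS](prednK n0) ltnS.
by rewrite leq_div.
Qed.

Lemma block_verticesS_le n k :
  (block_vertices n k.+1 <= block_vertices n k)%N.
Proof.
by rewrite /block_vertices ltnS expnSr divnMA leq_div.
Qed.

Lemma block_vertices_le4 n k :
  (block_vertices n k <= 4 * block_vertices n k.+1)%N.
Proof. by rewrite /block_vertices expnSr divnMA; lia. Qed.

Lemma block_vertices_le_div {R : realType} n k : (0 < n)%N ->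
  (block_vertices n k)%:R <= n%:R / 4 ^+ k + 1 :> R.
Proof.
move=> n0; rewrite /block_vertices -natr1 lerD2r.
rewrite ler_pdivlMr ?exprn_gt0 // -natrX -natrM ler_nat.
by rewrite (leq_trans (leq_trunc_div _ _)) // leq_pred.
Qed.

(** Bounding [ln h] below by 0 makes the root in [gV] at least [4 * ln 2]; the rest is rewritten
    through [(sqrt (2 ln 2)) ^ 2 = 2 ln 2]. *)
Lemma gE_ge {R : realType} (h : nat) : (0 < h)%N ->
  1 + Num.sqrt (2 * ln 2) + Num.sqrt (2 * ln 2) ^+ 2 / 3 <= gE R h.
Proof.
move=> h0.
have l2 : 0 < ln 2 :> R by rewrite ln_gt0 // ltr1n.
have lh : 0 <= ln h%:R :> R by rewrite ln_ge0 // ler1n.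
have s4 : 4 * ln 2 <= Num.sqrt (2 * ln 2 * (9 * ln h%:R + 8 * ln 2)) :> R.
  rewrite -[leLHS]ger0_norm -?sqrtr_sqr; last by lra.
  rewrite ler_wsqrtr // exprMn -subr_ge0.
  rewrite (_ : _ - _ = 18 * (ln 2 * ln h%:R)); last by ring.
  by rewrite !mulr_ge0 // ltW.
rewrite /gE /gV sqr_sqrtr; lra.
Qed.

(** * Thresholds, the exceptional event and the deterministic bound outside it *)

Section Threshold.
Context {R : realType} (h n K : nat) (h_gt0 : (0 < h)%N) (n_ge : (10 <= n)%N).

Let M : nat := h * n.
Let r : R := Num.sqrt (2 * ln 2).
Let U : R := M%:R / Num.sqrt h%:R.

Let n_gt0 : (0 < n)%N. Proof. by rewrite (leq_trans _ n_ge). Qed.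
Let M_ge : (10 <= M)%N. Proof. by rewrite (leq_trans n_ge) // leq_pmull. Qed.
Let M_gt0 : (0 < M)%N. Proof. by rewrite (leq_trans _ M_ge). Qed.
Let ln2_gt0 : 0 < @ln R 2. Proof. by rewrite ln_gt0 // ltr1n. Qed.
Let r_sqr : r ^+ 2 = 2 * ln 2.
Proof. by rewrite sqr_sqrtr // mulr_ge0 // ltW. Qed.
Let r_ge0 : 0 <= r. Proof. exact: sqrtr_ge0. Qed.
Let U_gt0 : 0 < U.
Proof. by rewrite divr_gt0 ?sqrtr_gt0 ?ltr0n. Qed.
Let U_sqr : U ^+ 2 = M%:R * n%:R.
Proof.
rewrite expr_div_n sqr_sqrtr // /M natrM; field.
by rewrite pnatr_eq0 -lt0n.
Qed.

(* [None] stands for the edge martingale on the whole time interval, [Some k] for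
   the volume martingale on the k-th time block. *)
Definition level (o : option 'I_K) : nat :=
  if o is Some k then block_vertices n k else n.

Definition level_coef (o : option 'I_K) (S : {set 'I_M}) :
    'I_M -> {ffun 'I_M -> 'I_M} -> R :=
  if o is Some k then
    block_coef (h * block_vertices n k.+1)%N (h * block_vertices n k)%N
  else edges_mart_coef S.

Definition level_dev (o : option 'I_K) (S : {set 'I_M}) f : R :=
  \sum_u level_coef o S u f * hit_dev S f u.

(* Hoeffding and the union bound need more than [r * U / 2] for the edges and more
   than [r * U / (sqrt 2 * 2 ^+ k)] for the k-th block.  Summed over all levels
   these bounds give [2.01 * (r * U)], which the quadratic term of [gE_ge] absorbs. *)
Definition level_bound (o : option 'I_K) : R :=
  (if o is Some k then 74 / 100 / 2 ^+ k else 53 / 100) * (r * U).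

(** Exponent per vertex left over after the union bound: 4 percent of [ln 2 / 4 ^ K], which every
    level can afford. *)
Definition rate : R := ln 2 / (25 * 4 ^+ K).

(** The term [level o * ln 2] pays for the [2 ^ level o] sets; the [- ln 2] absorbs the rounding up
    in [block_vertices]. *)
Lemma level_dev_tail (o : option 'I_K) (S : {set 'I_M}) :
  pa_prob (fun f => level_bound o < `|level_dev o S f|) <=
  2 * expR (- ((level o)%:R * ln 2 + rate * n%:R - ln 2)).
Proof.
have M0 : 10 <= M%:R :> R by rewrite ler_nat.
have n0 : 10 <= n%:R :> R by rewrite ler_nat.
have rU : (r * U) ^+ 2 = 2 * ln 2 * (M%:R * n%:R) by rewrite exprMn r_sqr U_sqr.
have x_ge1 : 1 <= 4 ^+ K :> R by rewrite exprn_ege1 ?ler1n.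
case: o => [k|] /=.
  have [y y_def] : exists y : R, y = 4 ^+ k by eexists.
  have y1 : 0 < y by rewrite y_def exprn_gt0.
  have yx : y <= 4 ^+ K by rewrite y_def ler_weXn2l ?ler1n // ltnW.
  set l := level_bound (Some k).
  have l2 : l ^+ 2 = (74 / 100) ^+ 2 * (2 * ln 2 * (M%:R * n%:R)) / y.
    rewrite /l /level_bound exprMn rU expr_div_n -exprM mulnC exprM.
    rewrite (_ : 2 ^+ 2 = 4) -?y_def; last by ring.
    by rewrite mulrAC.
  have l0 : 0 <= l.
    by rewrite /l /level_bound !mulr_ge0 ?divr_ge0 ?exprn_ge0 ?(ltW U_gt0).
  have K0 : 0 < 2 * M%:R + 1 :> R by lra.
  set t1 := (h * block_vertices n k.+1)%N; set t0 := (h * block_vertices n k)%N.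
  apply: le_trans (@pa_prob_tail R M S (block_coef t1 t0)
    (fun u => if (t1 <= u < t0)%N then c_coef R u.+1 / c_coef R M else 0)
    (2 * M%:R + 1) l _ _ _ K0 l0) _.
  - exact: block_coef_predictable.
  - move=> u f; rewrite /block_coef; case: ifP => _; last by rewrite normr0.
    by rewrite ger0_norm // divr_ge0 // ltW // c_coef_gt0.
  - apply: (block_coef_sqr_sum_le [ffun i => i]).
      by rewrite /t0 mulnCA leq_mul2l block_vertices_le4 orbT.
    by rewrite /t0 leq_mul2l block_vertices_le // orbT.
  rewrite ler_wpM2l // ler_expR lerN2 l2.
  have bv := @block_vertices_le_div R n k n_gt0; rewrite -y_def in bv.
  have ny : 0 <= n%:R / y * ln 2 :> R.
    by rewrite !mulr_ge0 ?invr_ge0 ?(ltW y1) ?(ltW ln2_gt0).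
  apply: (@le_trans _ _ (104 / 100 * (n%:R / y * ln 2))).
    have H1 : (block_vertices n k)%:R * ln 2 <= (n%:R / y + 1) * ln 2.
      by rewrite ler_wpM2r // ltW.
    have H2 : rate * n%:R <= 4 / 100 * (n%:R / y * ln 2).
      rewrite /rate.
      have -> : ln 2 / (25 * 4 ^+ K) * n%:R = 4 / 100 * (n%:R / 4 ^+ K * ln 2) :> R.
        by field; rewrite gt_eqF // (lt_le_trans ltr01).
      rewrite ler_wpM2l // ler_wpM2r ?(ltW ln2_gt0) // ler_wpM2l //.
      by rewrite lef_pV2 ?posrE // (lt_le_trans y1).
    lra.
  rewrite ler_pdivlMr //.
  (* Here [2.1904 = 4 * 0.74 ^ 2], and [1.04 * (2 * M + 1) <= 2.1904 * M] holds from [M >= 10]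
     on. *)
  rewrite [leRHS](_ : _ = (21904 / 10000 * M%:R) * (n%:R / y * ln 2)); last first.
    by field; rewrite gt_eqF.
  rewrite mulrAC ler_wpM2r //; lra.
apply: le_trans (@pa_prob_tail R M S (edges_mart_coef S) (fun=> 1) M%:R
  (level_bound None) _ _ _ _ _) _.
- exact: edges_mart_coef_predictable.
- exact: edges_mart_coef_le1.
- by rewrite expr1n sumr_const card_ord.
- lra.
- by rewrite /level_bound !mulr_ge0 // ltW.
rewrite ler_wpM2l // ler_expR lerN2 /level_bound exprMn rU.
rewrite (_ : 2 * _ / _ = 11236 / 10000 * (n%:R * ln 2)); last first.
  by field; rewrite gt_eqF //; lra.
have H2 : rate * n%:R <= 4 / 100 * (n%:R * ln 2).
  rewrite /rate mulrAC ler_pdivrMr ?mulr_gt0 ?exprn_gt0 //.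
  rewrite (_ : _ * (25 * _) = n%:R * ln 2 * 4 ^+ K); last by field.
  by rewrite mulrC; apply: ler_peMr => //; rewrite mulr_ge0 // ltW.
have H3 : 0 <= n%:R * ln 2 :> R by rewrite mulr_ge0 // ltW.
move: (ln 2) (n%:R * ln 2) (rate * n%:R) ln2_gt0 H2 H3 => a b c a0 H2 H3.
lra.
Qed.

Definition early (m : nat) : {set 'I_n} := [set i : 'I_n | (i < m)%N].

Definition deviates f : bool :=
  [exists o, exists S : {set 'I_n},
    (S \subset early (level o)) && (level_bound o < `|level_dev o (minis h S) f|)].

Lemma card_early m : (m <= n)%N -> #|early m| = m.
Proof.
move=> mn; rewrite cardsE -sum1_card.
by rewrite -(big_ord_widen n (fun=> 1%N)) // sum1_card card_ord.
Qed.

Lemma pa_prob_deviates :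
  pa_prob (deviates : pred {ffun 'I_M -> 'I_M}) <=
  4 * K.+1%:R * expR (- (rate * n%:R)).
Proof.
pose J : finType := (option 'I_K * {set 'I_n})%type.
apply: le_trans (@pa_prob_union R M J
  (fun j => j.2 \subset early (level j.1)) deviates
  (fun j f => level_bound j.1 < `|level_dev j.1 (minis h j.2) f|) _) _.
  by move=> f _ /existsP[lv /existsP[S /andP[So Sl]]]; exists (lv, S).
rewrite -(pair_big_dep xpredT
  (fun (o : option 'I_K) (S : {set 'I_n}) => S \subset early (level o))
  (fun o S => pa_prob (fun f => level_bound o < `|level_dev o (minis h S) f|))) /=.
apply: (@le_trans _ _ (\sum_(o : option 'I_K) 4 * expR (- (rate * n%:R)))).
  apply: ler_sum => o _.
  apply: (@le_trans _ _ (\sum_(S : {set 'I_n} | S \subset early (level o))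
    2 * expR (- ((level o)%:R * ln 2 + rate * n%:R - ln 2)))).
    by apply: ler_sum => S _; exact: level_dev_tail.
  have lo : (level o <= n)%N by case: o => [k|] //=; exact: block_vertices_le.
  have -> : \sum_(S : {set 'I_n} | S \subset early (level o))
      2 * expR (- ((level o)%:R * ln 2 + rate * n%:R - ln 2)) =
      2 ^+ level o * (2 * expR (- ((level o)%:R * ln 2 + rate * n%:R - ln 2))).
    rewrite (eq_bigl (mem (powerset (early (level o))))) => [|S].
      by rewrite sumr_const card_powerset card_early // -[LHS]mulr_natl natrX.
    by rewrite /= powersetE.
  rewrite (_ : 2 ^+ level o = expR ((level o)%:R * ln 2)); last first.
    by rewrite mulrC expRM_natr lnK // posrE.
  rewrite mulrCA -expRD.
  rewrite (_ : _ + _ = ln 2 + - (rate * n%:R)); last by ring.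
  by rewrite expRD lnK ?posrE // mulrA -natrM.
by rewrite sumr_const card_option card_ord -[leLHS]mulr_natl mulrCA mulrA.
Qed.

Lemma not_deviates f (S : {set 'I_n}) : backward f M -> ~~ deviates f ->
  `|inner_edges (minis h S) f M - mu R (minis h S) ^+ 2| <=
  201 / 100 * (r * U) +
  2 * (h * block_vertices n K)%:R *
    (c_coef R (h * block_vertices n K) / c_coef R M) + 1.
Proof.
move=> fle Nf.
have small o (S' : {set 'I_n}) : S' \subset early (level o) ->
    `|level_dev o (minis h S') f| <= level_bound o.
  move=> S'o; rewrite leNgt; apply: contra Nf => lo.
  by apply/existsP; exists o; apply/existsP; exists S'; rewrite S'o.
apply: le_trans (edges_mu_le _ _ M_gt0) _; rewrite lerD2r.
pose tk k := (h * block_vertices n k)%N.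
have tkM k : (tk k <= M)%N by rewrite leq_mul2l block_vertices_le ?orbT.
have tkS k : (tk k.+1 <= tk k)%N by rewrite leq_mul2l block_verticesS_le orbT.
pose W t := volume_mart (minis h S) f t / c_coef R M.
have edges_small : `|edges_mart (minis h S) f M| <= 53 / 100 * (r * U).
  rewrite edges_mart_sum; apply: (small None S).
  by apply/fintype.subsetP => i _; rewrite inE /=.
have block_small (k : 'I_K) : `|W (tk k) - W (tk k.+1)| <= 74 / 100 / 2 ^+ k * (r * U).
  (* The block ends before later vertices are born, so replacing [S] by [S'] does not change the two
     values of the martingale. *)
  pose S' := S :&: early (block_vertices n k).
  have := small (Some k) S' (subsetIr _ _).
  rewrite /level_dev /= (@block_coef_sum R M _ _ _ _ (tkS k) (tkM k)) /W -mulrBl.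
  have SS' t : (t <= tk k)%N ->
      volume_mart (minis h S') f t = volume_mart (minis h S) f t :> R.
    move=> ttk; apply: volume_mart_restrict => [i it|i it].
      by apply: fle; rewrite ltn_ord.
    rewrite !inE /= ltn_divLR // [(block_vertices n k * h)%N]mulnC.
    by rewrite (leq_trans it ttk) andbT.
  by rewrite !SS'.
(* Geometric sum of the block bounds, [1.48 = 2 * 0.74]; with the edge bound 0.53 it makes up
   2.01. *)
have tele j : (j <= K)%N ->
    `|W M - W (tk j)| <= 148 / 100 * (1 - 1 / 2 ^+ j) * (r * U).
  elim: j => [|j IH] jK.
    rewrite /tk block_vertices0 // -/M subrr normr0 expr0 divr1 subrr mulr0.
    by rewrite mul0r.
  rewrite -[W M - _](subrKA (W (tk j))) (le_trans (ler_normD _ _)) //.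
  apply: (le_trans (lerD (IH (ltnW jK)) (block_small (Ordinal jK)))) => /=.
  rewrite -mulrDl ler_wpM2r ?mulr_ge0 ?(ltW U_gt0) //.
  rewrite le_eqVlt; apply/orP; left; apply/eqP; rewrite exprS; field.
  by rewrite expf_neq0.
have WK : `|W (tk K)| <= 2 * (tk K)%:R * (c_coef R (tk K) / c_coef R M).
  rewrite /W normrM [X in _ * X]ger0_norm ?invr_ge0 ?(ltW (c_coef_gt0 _)) //.
  by rewrite mulrA ler_wpM2r ?invr_ge0 ?(ltW (c_coef_gt0 _)) // -natrM volume_mart_le.
have WM : `|W M| <= 148 / 100 * (r * U) + 2 * (tk K)%:R * (c_coef R (tk K) / c_coef R M).
  rewrite -[W M](subrK (W (tk K))) (le_trans (ler_normD _ _)) // lerD //.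
  apply: le_trans (tele K (leqnn _)) _; rewrite ler_wpM2r ?mulr_ge0 ?(ltW U_gt0) //.
  by rewrite ler_piMr // gerBl divr_ge0 ?exprn_ge0.
by rewrite -/(W M) -/(tk K); lra.
Qed.

Context (K_ge : (1600 * h <= 4 ^ K)%N) (n_ge_h : (1600 * h <= n)%N).

(** Both lower bounds by [1600 * h] contribute [n / 1600], so the remaining time [t] is at most
    [n / 800]; then [4 * t * (M + 1/2) <= 8 * t * M <= U ^+ 2 / 100]. *)
Let early_mart_le :
  2 * (h * block_vertices n K)%:R *
    (c_coef R (h * block_vertices n K) / c_coef R M) <= U / 10.
Proof.
have c0 i : 0 <= c_coef R i by rewrite ltW // c_coef_gt0.
rewrite -(@ler_pXn2r _ 2) // ?nnegrE; last 2 first.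
- by rewrite !mulr_ge0 ?invr_ge0.
- by rewrite mulr_ge0 // ltW.
set t := (h * block_vertices n K)%N.
rewrite (_ : (2 * t%:R * (c_coef R t / c_coef R M)) ^+ 2 =
  4 * t%:R * ((c_coef R t / c_coef R M) ^+ 2 * t%:R)); last by ring.
apply: (@le_trans _ _ (4 * t%:R * (M%:R + 2^-1))).
  by rewrite ler_wpM2l ?mulr_ge0 // c_coef_ratio_sqr_le.
rewrite exprMn U_sqr.
have M1 : 10 <= M%:R :> R by rewrite ler_nat.
have t_le : 800 * t%:R <= n%:R :> R.
  have x0 : 0 < 4 ^+ K :> R by rewrite exprn_gt0.
  have Kx : 1600 * h%:R <= 4 ^+ K :> R by rewrite -natrX -natrM ler_nat.
  have nh : 1600 * h%:R <= n%:R :> R by rewrite -natrM ler_nat.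
  have bv := @block_vertices_le_div R n K n_gt0.
  have nx : 1600 * h%:R * (n%:R / 4 ^+ K) <= n%:R :> R.
    by rewrite mulrA ler_pdivrMr // mulrC ler_wpM2l.
  have := ler_wpM2l (ler0n R (1600 * h)) bv.
  rewrite /t natrM natrM; lra.
have : 8 * t%:R * M%:R <= n%:R / 100 * M%:R :> R by rewrite ler_wpM2r //; lra.
have : 0 <= t%:R * (M%:R - 2^-1) :> R by rewrite mulr_ge0 //; lra.
rewrite exprVn; lra.
Qed.

Lemma edges_mu_le_gE f (S : {set 'I_n}) : backward f M -> ~~ deviates f ->
  `|inner_edges (minis h S) f M - mu R (minis h S) ^+ 2| <= gE R h * U.
Proof.
move=> fle Nf; apply: le_trans (not_deviates S fle Nf) _.
have U10 : 10 <= U.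
  rewrite -(@ler_pXn2r _ 2) ?nnegrE ?(ltW U_gt0) // U_sqr.
  by rewrite (_ : 10 ^+ 2 = (10 * 10)%:R) -?natrM ?ler_nat ?leq_mul // natrM.
have := ler_wpM2r (ltW U_gt0) (@gE_ge R h h_gt0); rewrite -/r.
(* The early part and the additive 1 cost [U / 10] each, leaving [0.8 + r ^+ 2 / 3 >= 1.01 * r] to
   check; 303/200 is the minimiser. *)
have : 0 <= (100 / 300 * r ^+ 2 - 101 / 100 * r + 80 / 100) * U.
  rewrite mulr_ge0 ?(ltW U_gt0) //.
  have := sqr_ge0 (r - 303 / 200); lra.
have := early_mart_le; lra.
Qed.

End Threshold.

(** * Passage to the limit *)

Lemma pa_prob_sub {R : realType} (M : nat)
    (A B : pred {ffun 'I_M -> 'I_M}) :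
  (forall f, backward f M -> A f -> B f) -> pa_prob A <= pa_prob B :> R.
Proof.
move=> AB; apply: le_trans (@pa_prob_le R M A (fun f => (B f)%:R) _ _) _ => //.
  by move=> f fle /(AB _ fle) ->.
rewrite /pa_prob [leRHS]big_mkcond; apply: ler_sum => f _.
by case: (B f); rewrite ?mulr1 ?mulr0.
Qed.

Lemma pa_probC {R : realType} (M : nat) (A : pred {ffun 'I_M -> 'I_M}) :
  pa_prob A = 1 - pa_prob (predC A) :> R.
Proof. by rewrite -(sum_pa_weight R M) (bigID A) /= addrK. Qed.

Lemma cvg_rate {R : realType} (K : nat) (C : R) :
  C * expR (- (rate K * n%:R)) @[n --> \oo] --> (0 : R).
Proof.
have rate_gt0 : 0 < rate K :> R.
  by rewrite divr_gt0 ?ln_gt0 ?ltr1n // mulr_gt0 // exprn_gt0.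
rewrite -[X in _ --> X](mulr0 C); apply: cvgMr.
rewrite (_ : (fun n => _) = GRing.exp (expR (- rate K))); last first.
  by apply/funext => n; rewrite -mulNr expRM_natr.
apply: cvg_expr; rewrite ger0_norm ?expR_ge0 //.
by rewrite -expR0 ltr_expR oppr_lt0.
Qed.

Theorem theorem9 (R : realType) (h : nat) (h_gt0 : (0 < h)%N)
    (eps : R) (eps_gt0 : 0 < eps) :
  (fun n : nat =>
     pa_Pr R h (fun G : multigraph 'I_n =>
       [forall S : {set 'I_n},
          `|(edges_within G S)%:R - mu R (minis h S) ^+ 2|
            <= (1 + eps) * gE R h * ((h * n)%:R / Num.sqrt h%:R)]))
    @ \oo --> (1 : R).
Proof.
(* [4 ^ 6 >= 1600] and [4 ^ h >= h]. The number of blocks depends on [h] alone, so [rate K] stays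
   fixed as [n] grows. *)
pose K := (h + 6)%N.
have K_ge : (1600 * h <= 4 ^ K)%N.
  rewrite expnD mulnC leq_mul //; exact/ltnW/ltn_expl.
have cvg1 : 1 - 4 * K.+1%:R * expR (- (rate K * n%:R)) @[n --> \oo] --> (1 : R).
  rewrite -[X in _ --> X](subr0 1); apply: cvgB; first exact: cvg_cst.
  exact: cvg_rate.
apply: (squeeze_cvgr _ cvg1 (cvg_cst (1 : R))).
near=> n.
have n10 : (10 <= n)%N by near: n; exact: nbhs_infty_ge.
have nh : (1600 * h <= n)%N by near: n; exact: nbhs_infty_ge.
set Ev := (X in pa_Pr R h X).
have -> : pa_Pr R h Ev =
    pa_prob (fun f : {ffun 'I_(h * n) -> 'I_(h * n)} => Ev (pa_graph f)) by exact: erefl.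
rewrite pa_probC; apply/andP; split; last first.
  by rewrite gerBl; apply: sumr_ge0 => f _; exact: pa_weight_ge0.
rewrite lerD2l lerN2.
apply: (@le_trans _ _ (pa_prob (@deviates R h n K))); last exact: pa_prob_deviates.
apply: pa_prob_sub => f fle; apply: contraR => Nf.
apply/forallP => S; rewrite inner_edges_minis.
have e_le := @edges_mu_le_gE R h n K h_gt0 n10 K_ge nh f S fle Nf.
apply: (le_trans e_le); rewrite ler_wpM2r ?divr_ge0 ?sqrtr_ge0 //.
have r_ge0 : 0 <= Num.sqrt (2 * ln 2) :> R by exact: sqrtr_ge0.
have r2_ge0 := sqr_ge0 (Num.sqrt (2 * ln 2) : R).
(* Passing from [gE] to [(1 + eps) * gE] uses that [gE] is nonnegative. *)
rewrite ler_peMl ?lerDl ?(ltW eps_gt0) //.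
have := @gE_ge R h h_gt0; lra.
Unshelve. all: by end_near. Qed.
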